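(* Let $n\ge 0$ and let $0<a_0\le a_1\le\cdots\le a_n$ be integers. Let $M=x_0^{a_0}x_1^{a_1}\cdots x_n^{a_n}\in\mathbb{R}[x_0,\ldots,x_n]$. Then $$\mathrm{rk}_{\mathbb{R}}(M)\le \frac{1}{2a_0}\prod_{i=0}^n (a_i+a_0).$$
   Context: For a field $\mathbb{K}$ and a homogeneous polynomial $F\in\mathbb{K}[x_0,\ldots,x_n]$ of degree $d$, a Waring decomposition of $F$ over $\mathbb{K}$ is an expression $F=\sum_{i=1}^s c_iL_i^d$ with $c_i\in\mathbb{K}$ and $L_i\in\mathbb{K}[x_0,\ldots,x_n]$ linear forms (homogeneous of degree 1). The Waring rank of $F$ over $\mathbb{K}$, denoted $\mathrm{rk}_{\mathbb{K}}(F)$, is the smallest $s$ for which such a decomposition exists. *)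

(* Defs.v *)
From HB Require Import structures.
From mathcomp Require Import all_boot all_order all_algebra.
From mathcomp Require Import mpoly.

Set Implicit Arguments.
Unset Strict Implicit.
Unset Printing Implicit Defensive.

Import GRing.Theory.
Local Open Scope ring_scope.

(* [(msize F).-1] is the total degree of [F], since [msize] is the degree
   plus one (and [0] on the zero polynomial). *)
Definition waring_decomposition (K : fieldType) (n : nat) (F : {mpoly K[n]})
    (s : nat) (c : 'I_s -> K) (L : 'I_s -> {mpoly K[n]}) : Prop :=
  (forall i, L i \is 1.-homog) /\
  F = \sum_(i < s) c i *: L i ^+ (msize F).-1.

Definition has_waring_decomposition (K : fieldType) (n : nat)
    (F : {mpoly K[n]}) (s : nat) : Prop :=
  exists (c : 'I_s -> K) (L : 'I_s -> {mpoly K[n]}),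
    waring_decomposition F c L.

(* The Waring rank as a relation: for a form with no decomposition at all,
   as can happen in positive characteristic, no [r] qualifies. *)
Definition is_waring_rank (K : fieldType) (n : nat) (F : {mpoly K[n]})
    (r : nat) : Prop :=
  has_waring_decomposition F r /\
  forall s : nat, has_waring_decomposition F s -> (r <= s)%N.

(* Main.v *)
(** Put [m i = a i + a 0].  For [i > 0] there is a real quadrature with [m i]
    nodes whose moments of degrees [0, ..., m i] all vanish except the one of
    degree [a i], which is [1]: any [m i] distinct nodes realise the moments of
    degree below [m i], and the moment of degree [m i] then vanishes as soon as
    the monic polynomial vanishing at the nodes has no monomial of degree [a i].
    Sum the [d]-th powers of [x_0 + r_1 x_1 + ... + r_n x_n] against the product
    of these quadratures: the coefficient of [x^b] is a multiple of the product
    of the moments of degrees [b_1, ..., b_n].  If it is nonzero then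
    [a i <= b_i] for [i > 0], so [b_i <= m i] because both exponents have total
    degree [d], and hence [b = a]. *)
Require Import Defs.
From mathcomp Require Import all_boot all_order all_algebra.
From mathcomp Require Import mpoly reals.
From mathcomp Require Import boolp ring zify.

Set Implicit Arguments.
Unset Strict Implicit.
Unset Printing Implicit Defensive.

Import Order.TTheory GRing.Theory Num.Theory.
Local Open Scope ring_scope.

(** Multiplying [h] by ['X + c] with [c > 0] gives the coefficients [h_(l-1) + c * h_l]: no term is
    negative, and one is positive. *)
Lemma coef_prod_XaddC_gt0 (R : realFieldType) (p l : nat) :
  (l <= p)%N -> 0 < (\prod_(j < p) ('X + (j.+1%:R : R)%:P))`_l.
Proof.
elim: p l => [|p IHp] l.
  by rewrite leqn0 big_ord0 => /eqP ->; rewrite coef1 ltr01.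
rewrite big_ord_recr /= mulrDr coefD coefMX coefMC.
set h := \prod_(_ < p) _ in IHp *.
have h_ge0 i : 0 <= h`_i.
  have [/IHp/ltW // | lt_pi] := leqP i p.
  rewrite nth_default // /h (eq_bigr (fun j : 'I_p => 'X - (- j.+1%:R : R)%:P)).
    by rewrite size_prod_XsubC /index_enum -enumT size_enum_ord.
  by move=> j _; rewrite polyCN opprK.
case: l => [_|l le_lp] /=; first by rewrite add0r mulr_gt0 ?IHp ?ltr0Sn.
by rewrite ltr_pwDl ?IHp // mulr_ge0 ?ler0n.
Qed.

(* The nodes are [-1, ..., -m+1] and the one positive node which cancels the
   monomial of degree [k]. *)
Lemma exists_roots_coef0 (R : realFieldType) (m k : nat) :
  (0 < k < m)%N -> exists r : nat -> R,
    {in gtn m &, injective r} /\ (\prod_(j < m) ('X - (r j)%:P))`_k = 0.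
Proof.
case: m => [|p]; first by rewrite ltn0 andbF.
case: k => // k /= lt_kp.
set h := \prod_(j < p) ('X + (j.+1%:R : R)%:P).
have h_gt0 : 0 < h`_k /\ 0 < h`_k.+1.
  by rewrite !coef_prod_XaddC_gt0 // ltnW // ltnW.
case: h_gt0 => hk_gt0 hk1_gt0.
(* After the shift of [k], the coefficient to cancel in [h * ('X - s)] is [h_k - s * h_(k+1)]. Since
   [s > 0], it differs from the negative nodes. *)
pose s := h`_k / h`_k.+1.
have s_gt0 : 0 < s by rewrite divr_gt0.
exists (fun j => if (j < p)%N then - j.+1%:R else s); split.
  move=> i j; rewrite !inE !ltnS => le_ip le_jp.
  case: ltnP => [lt_ip|le_pi]; case: ltnP => [lt_jp|le_pj].
  - by move/oppr_inj/eqP; rewrite eqr_nat => /eqP[].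
  - by move=> e; have := ltr0Sn R i; rewrite -oppr_lt0 e ltNge ltW.
  - by move=> e; have := ltr0Sn R j; rewrite -oppr_lt0 -e ltNge ltW.
  - by move=> _; lia.
rewrite big_ord_recr /= ltnn (_ : \prod_(_ < p) _ = h).
  rewrite mulrBr coefB coefMX coefMC /= /s mulrCA divff ?mulr1 ?subrr //.
  by rewrite gt_eqF.
by apply: eq_bigr => j _; rewrite ltn_ord polyCN opprK.
Qed.

(** Distinct nodes make the Vandermonde matrix invertible; the weights are column [k] of its
    inverse. *)
Lemma exists_dual_weights (F : fieldType) (m : nat) (r : 'I_m -> F)
    (k : 'I_m) : injective r ->
  exists c : 'I_m -> F,
    forall l : 'I_m, \sum_(j < m) c j * r j ^+ l = (l == k)%:R.
Proof.
move=> r_inj; pose V := Vandermonde m (\row_j r j).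
have V_unit : V \in unitmx.
  rewrite unitmxE unitfE det_Vandermonde.
  apply/prodf_neq0 => i _; apply/prodf_neq0 => j lt_ij.
  rewrite !mxE subr_eq0; apply: contraTneq lt_ij => /r_inj ->.
  by rewrite ltnn.
pose c := invmx V *m delta_mx k ord0 : 'cV_m.
exists (fun j => c j ord0) => l.
have : (V *m c) l ord0 = (l == k)%:R by rewrite mulKVmx // mxE eqxx andbT.
by move=> <-; rewrite mxE; apply: eq_bigr => j _; rewrite !mxE mulrC.
Qed.

Lemma exists_quadrature (R : realFieldType) (m k : nat) :
  (0 < k < m)%N -> exists c r : nat -> R,
    forall l, (l <= m)%N -> \sum_(j < m) c j * r j ^+ l = (l == k)%:R.
Proof.
move=> km; have [r [r_inj gk0]] := exists_roots_coef0 R km.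
have lt_km : (k < m)%N by case/andP: km.
have r_inj' : injective (fun j : 'I_m => r j).
  by move=> i j e; apply/val_inj/r_inj; rewrite // inE ltn_ord.
have [c cP] := exists_dual_weights (Ordinal lt_km) r_inj'.
exists (fun j => if insub j is Some i then c i else 0), r => l le_lm.
rewrite (eq_bigr (fun j : 'I_m => c j * r j ^+ l)); last first.
  by move=> j _; rewrite valK.
case: (ltnP l m) => [lt_lm|le_ml]; first exact: cP (Ordinal lt_lm).
have -> : l = m by lia.
rewrite gtn_eqF //.
set g := \prod_(j < m) _ in gk0.
have size_g : size g = m.+1.
  by rewrite size_prod_XsubC /index_enum -enumT size_enum_ord.
have gm : g`_m = 1.
  have /monicP := monic_prod_XsubC (index_enum 'I_m) xpredT (fun j => r j).
  by rewrite /lead_coef -/g size_g.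
(* Each node is a root of the monic [g], so its [m]-th power reduces to lower ones; the moment of
   degree [m] becomes [- g_k = 0]. *)
have r_pow (j : 'I_m) : r j ^+ m = - \sum_(i < m) g`_i * r j ^+ i.
  have : g.[r j] = 0.
    by rewrite horner_prod (bigD1 j) //= hornerXsubC subrr mul0r.
  by rewrite horner_coef size_g big_ord_recr /= gm mul1r => /eqP;
     rewrite addrC addr_eq0 => /eqP.
under eq_bigr => j _ do rewrite r_pow mulrN mulr_sumr.
rewrite sumrN exchange_big /= big1 ?oppr0 // => i _.
under eq_bigr => j _ do rewrite mulrCA.
rewrite -mulr_sumr cP; case: eqVneq => [->|_]; last by rewrite mulr0.
by rewrite gk0 mul0r.
Qed.

Section PowerExpansion.

Variables (R : comNzRingType) (n d : nat).

(** Exponent of the monomial obtained by picking the variable [g j] from the [j]-th of [d] factors.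
    Multinomial coefficients thus appear as fibre cardinals. *)
Definition fiber_mnm (g : {ffun 'I_d -> 'I_n}) : 'X_{1..n} :=
  (\sum_(j < d) U_(g j))%MM.

Lemma fiber_mnmE g i : fiber_mnm g i = #|[pred j | g j == i]|.
Proof.
by rewrite mnm_sumE -sum1_card [RHS]big_mkcond /=; apply: eq_bigr => j _;
   rewrite mnm1E inE; case: (g j == i).
Qed.

Lemma sum_fiber_mnm g : (\sum_i fiber_mnm g i = d)%N.
Proof.
rewrite -mdegE mdeg_sum (eq_bigr (fun=> 1%N)) => [|j _]; last exact: mdeg1.
by rewrite sum1_card card_ord.
Qed.

Lemma linear_form_exp (v : 'I_n -> R) :
  (\sum_i v i *: 'X_i : {mpoly R[n]}) ^+ d =
  \sum_(g : {ffun 'I_d -> 'I_n})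
     (\prod_i v i ^+ fiber_mnm g i) *: 'X_[fiber_mnm g].
Proof.
rewrite -{1}(card_ord d) -prodr_const bigA_distr_bigA.
apply: eq_bigr => g _; rewrite scaler_prod; congr (_ *: _); last first.
  by rewrite (big_morph (fun m => 'X_[R, m]) (@mpolyXD n R) (@mpolyX0 n R)).
rewrite (partition_big g xpredT) //=; apply: eq_bigr => i _.
by rewrite fiber_mnmE -prodr_const; apply: eq_bigr => j /eqP ->.
Qed.

End PowerExpansion.

(** List each variable [i] with multiplicity [m i]. This shows that the multinomial coefficient of
    [m] is positive. *)
Lemma exists_fiber_mnm (n : nat) (m : 'X_{1..n}) :
  exists g : {ffun 'I_(mdeg m) -> 'I_n}, fiber_mnm g = m.
Proof.
pose s := flatten [seq nseq (m i) i | i <- enum 'I_n].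
have size_s : size s == mdeg m.
  rewrite size_flatten /shape -map_comp sumnE big_map big_enum mdegE.
  by apply/eqP/eq_bigr => i _; rewrite /= size_nseq.
pose t := Tuple size_s; exists [ffun j => tnth t j].
apply/mnmP => i; rewrite fiber_mnmE.
have -> : #|[pred j | [ffun j => tnth t j] j == i]| = count_mem i t.
  rewrite -[in RHS](map_tnth_enum t) count_map enumT -size_filter cardE.
  by rewrite /enum_mem; congr size; apply: eq_filter => j; rewrite !inE ffunE.
rewrite count_flatten -map_comp sumnE big_map big_enum (bigD1 i) //=.
rewrite count_nseq /= eqxx mul1n big1 ?addn0 // => j ji.
by rewrite count_nseq /= (negPf ji).
Qed.

Lemma has_waring_decomposition_card (K : fieldType) (n : nat)
    (F : {mpoly K[n]}) (I : finType) (A : {pred I})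
    (c : I -> K) (L : I -> {mpoly K[n]}) :
  (forall i, L i \is 1.-homog) ->
  F = \sum_(i in A) c i *: L i ^+ (msize F).-1 ->
  has_waring_decomposition F #|A|.
Proof.
move=> L_lin F_sum; exists (fun i => c (enum_val i)), (fun i => L (enum_val i)).
by split=> [i|]; rewrite // {1}F_sum big_enum_val.
Qed.

Lemma exists_waring_rank (K : fieldType) (n : nat) (F : {mpoly K[n]}) (s : nat) :
  has_waring_decomposition F s ->
  exists2 r, is_waring_rank F r & (r <= s)%N.
Proof.
move=> Fs; pose P := fun r => `[< has_waring_decomposition F r >].
have exP : exists r, P r by exists s; apply/asboolP.
case: (ex_minnP exP) => r /asboolP Fr r_min.
by exists r; [split=> // t Ft|]; apply: r_min; apply/asboolP.
Qed.

(* Each variable carries its own quadrature, with nodes [r i j] and weights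
   [c i j]. *)
Lemma waring_of_quadrature (K : numFieldType) (n : nat) (m : 'X_{1..n})
    (N : 'I_n -> nat) (c r : 'I_n -> nat -> K) :
  (forall b : 'X_{1..n}, mdeg b = mdeg m ->
     \prod_i \sum_(j < N i) c i j * r i j ^+ b i = (b == m)%:R) ->
  has_waring_decomposition ('X_[m] : {mpoly K[n]}) (\prod_i N i)%N.
Proof.
move=> moments; set d := mdeg m.
(* A common bound puts all choices of nodes in one function type, where [family Q] selects the
   admissible ones. *)
pose M := (\max_i N i)%N.
have le_NM i : (N i <= M)%N by exact: (@leq_bigmax _ N i).
pose Q i := [pred j : 'I_M | (j < N i)%N].
have card_Q i : #|Q i| = N i.
  by rewrite -sum1_card -(big_ord_widen M (fun=> 1%N)) // sum1_card card_ord.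
have -> : (\prod_i N i)%N = #|(family Q : {pred {ffun 'I_n -> 'I_M}})|.
  rewrite card_family foldrE big_map big_enum /=.
  by apply: eq_bigr => i _; rewrite card_Q.
(* The multinomial coefficient of [m], to be divided out of the weights. *)
pose W := #|[pred g : {ffun 'I_d -> 'I_n} | fiber_mnm g == m]|.
have W_neq0 : W%:R != 0 :> K.
  have [g gm] := exists_fiber_mnm m.
  by rewrite pnatr_eq0 -lt0n; apply/card_gt0P; exists g; rewrite inE gm.
apply: (@has_waring_decomposition_card _ _ _ _ (family Q)
  (fun f : {ffun 'I_n -> 'I_M} => W%:R^-1 * \prod_i c i (f i))
  (fun f : {ffun 'I_n -> 'I_M} => \sum_i r i (f i) *: 'X_i)).
  by move=> f; apply: rpred_sum => i _; rewrite dhomogZ // dhomogX /= mdeg1.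
rewrite msizeX /= -/d.
under eq_bigr => f _.
  rewrite linear_form_exp scaler_sumr.
  under [\sum_g _]eq_bigr => g _ do rewrite scalerA -mulrA -big_split /=.
  over.
rewrite exchange_big /=.
under [\sum_g _]eq_bigr => g _.
  rewrite -scaler_suml -mulr_sumr.
  (* The sum over choices of nodes factors into one-variable moments. *)
  rewrite -(bigA_distr_big_dep Q (fun i j => c i j * r i j ^+ fiber_mnm g i)).
  under [\prod_(i < n) _]eq_bigr => i _.
    rewrite -(big_ord_widen M (fun j => c i j * r i j ^+ fiber_mnm g i)) //.
    over.
  rewrite moments; last by rewrite mdegE sum_fiber_mnm.
  over.
rewrite (bigID (fun g => fiber_mnm g == m)) /= addrC big1 ?add0r; last first.
  by move=> g /negPf ->; rewrite mulr0 scale0r.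
under eq_bigr => g /eqP -> do rewrite eqxx mulr1.
by rewrite sumr_const -/W -scaler_nat scalerA divff // scale1r.
Qed.

Theorem theorem3p1 (R : realType) (n : nat) (a : 'I_n.+1 -> nat)
    (a0_gt0 : (0 < a ord0)%N)
    (a_mono : forall i j : 'I_n.+1, (i <= j)%N -> (a i <= a j)%N) :
  exists r : nat,
    is_waring_rank (\prod_(i < n.+1) 'X_i ^+ a i : {mpoly R[n.+1]}) r /\
    (r%:R : R) <= 1 / (2 * (a ord0)%:R) * \prod_(i < n.+1) ((a i)%:R + (a ord0)%:R).
Proof.
pose m : 'X_{1..n.+1} := [multinom a i | i < n.+1].
(* The variable of index [0] keeps coefficient [1]: its single node has all moments equal to [1]. *)
pose N (i : 'I_n.+1) := if i == ord0 then 1%N else (a i + a ord0)%N.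
have quad (i : 'I_n.+1) : exists cr : (nat -> R) * (nat -> R),
    forall l, (l <= a i + a ord0)%N ->
      \sum_(j < N i) cr.1 j * cr.2 j ^+ l = ((i == ord0) || (l == a i))%:R.
  rewrite /N; case: eqP => [_|_].
    by exists (fun=> 1, fun=> 1) => l _; rewrite big_ord1 expr1n mulr1.
  have [|c [r cr]] := @exists_quadrature R (a i + a ord0) (a i).
    by have := a_mono ord0 i (leq0n _); lia.
  by exists (c, r).
have [cr crP] := choice quad.
have : has_waring_decomposition ('X_[m] : {mpoly R[n.+1]}) (\prod_i N i)%N.
  apply: (@waring_of_quadrature _ _ _ _ (fun i => (cr i).1) (fun i => (cr i).2)).
  move=> b deg_b; case: eqVneq => [->|b_neq_m].
    by rewrite big1 // => i _; rewrite mnmE crP ?leq_addr // eqxx orbT.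
  suff [i [i_neq0 b_neq_a b_le]] :
      exists i, [/\ i != ord0, b i != a i & (b i <= a i + a ord0)%N].
    by rewrite (bigD1 i) //= crP // (negPf i_neq0) (negPf b_neq_a) mul0r.
  have [/existsP[i /andP[i_neq0 lt_ba]] | ] :=
    boolP [exists i, (i != ord0) && (b i < a i)%N].
    by exists i; split; rewrite // ?ltn_eqF // ltnW // ltn_addr.
  rewrite negb_exists => /forallP le_ab.
  have {}le_ab i : i != ord0 -> (a i <= b i)%N.
    by move=> i_neq0; have := le_ab i; rewrite i_neq0 /= -leqNgt.
  have deg_eq :
      (b ord0 + \sum_(i | i != ord0) b i = a ord0 + \sum_(i | i != ord0) a i)%N.
    move: deg_b; rewrite !mdegE (bigD1 ord0) //= => ->.
    by rewrite (bigD1 ord0) //= mnmE; congr addn; apply: eq_bigr => i _;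
      rewrite mnmE.
  (* The other exponents of nonzero index are at least those of [a], so any excess of [b i] over
     [a i] is taken from [a ord0]. *)
  have b_le i : i != ord0 -> (b i <= a i + a ord0)%N.
    move=> i_neq0; move: deg_eq; rewrite !(bigD1 i i_neq0) /=.
    move=> sum_eq; rewrite -(leq_add2r (\sum_(j | (j != ord0) && (j != i)) b j)).
    apply: leq_trans (leq_addl (b ord0) _) _.
    rewrite sum_eq addnA [(a ord0 + _)%N]addnC.
    by rewrite leq_add2l leq_sum // => j /andP[/le_ab].
  have [/existsP[i /andP[i_neq0 b_neq_a]] | ] :=
    boolP [exists i, (i != ord0) && (b i != a i)].
    by exists i; split; rewrite // b_le.
  rewrite negb_exists => /forallP eq_ba.
  have {}eq_ba i : i != ord0 -> b i = a i.
    by move=> i_neq0; have := eq_ba i; rewrite i_neq0 /= negbK => /eqP.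
  case/eqP: b_neq_m; apply/mnmP => i; rewrite mnmE.
  have [-> | /eq_ba //] := eqVneq i ord0.
  by move: deg_eq; rewrite (eq_bigr _ eq_ba) => /addIn.
rewrite mpolyXE_id (eq_bigr (fun i => 'X_i ^+ a i)) => [|i _]; last first.
  by rewrite mnmE.
case/exists_waring_rank => r r_rank le_rN; exists r; split=> //.
have a0_neq0 : (a ord0)%:R != 0 :> R by rewrite pnatr_eq0 -lt0n.
suff -> : 1 / (2 * (a ord0)%:R) * \prod_(i < n.+1) ((a i)%:R + (a ord0)%:R)
    = (\prod_i N i)%N%:R :> R by rewrite ler_nat.
(* The factor of index [0] is [2 * a ord0], which cancels the denominator. *)
rewrite !big_ord_recl /= mul1n mulrA (_ : _ / _ * _ = 1) ?mul1r; last by field.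
by rewrite natr_prod; apply: eq_bigr => i _; rewrite natrD.
Qed.
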